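(* For all $\alpha\in\mathbb{N}=\{1,2,\dots\}$ and every $n\in\mathbb{N}$, the number of rational Schröder paths with slope $\alpha$ from $(0,0)$ to $(n,\alpha n)$ equals the cardinality of $\mathfrak{D}^{\pmb{\sigma}}_n(\alpha-1,1)$: \[\#\mathcal{S}_n(\alpha)=\#\mathfrak{D}^{\pmb{\sigma}}_n(\alpha-1,1).\]
   Context: $\mathcal{S}_n(\alpha)$ is the set of lattice paths from $(0,0)$ to $(n,\alpha n)$ with steps $\mathsf{E}=(1,0)$, $\mathsf{N}=(0,1)$, $\mathsf{D}=(1,1)$ staying weakly above the line $y=\alpha x$. For an integer $a\ge 0$ and a sequence $\mathbf{c}=(c_1,c_2,\dots)$ of nonnegative integers, $\mathfrak{D}^{\mathbf{c}}_n(a,1)$ is the set of colored Dyck paths obtained as follows: Dyck paths (words in $u,d$) of semilength $(a+1)n$ that are concatenations of strings $d$ and $u^{(a+1)j}d^{j}$ ($j=1,\dots,n$) — equivalently, every maximal run of up-steps has length $(a+1)j$ for some $j\ge1$ and is immediately followed by at least $j$ down-steps — where each maximal ascent $u^{(a+1)j}$ is assigned one of $c_j$ colors (two such paths are the same only if the underlying path and all colors agree). The sequence $\pmb{\sigma}=(\sigma_1,\sigma_2,\dots)$ is given by $\sigma_j=2s_{j-1}$, where $s_m$ is the little Schröder number: the number of lattice paths from $(0,0)$ to $(m,m)$ with steps $\mathsf{E},\mathsf{N},\mathsf{D}$ staying weakly above $y=x$ with no $\mathsf{D}$-step on $y=x$. Equivalently, $\sigma_j$ is the number of Schröder paths from $(0,0)$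 to $(j,j)$ lying strictly above $y=x$ except at their endpoints, together with (for $j=1$) the path $\mathsf{D}$; so $\sigma_1=2$ and $\sigma_2,\sigma_3,\dots=2,6,22,90,\dots$ are the large Schröder numbers. *)

(* Defs.v *)
From HB Require Import structures.
From mathcomp Require Import all_boot.

Set Implicit Arguments.
Unset Strict Implicit.
Unset Printing Implicit Defensive.

Inductive step := StepE | StepN | StepD.

Definition step_code (s : step) : option bool :=
  match s with StepE => Some true | StepN => Some false | StepD => None end.

Definition step_decode (o : option bool) : step :=
  match o with Some true => StepE | Some false => StepN | None => StepD end.

Lemma step_codeK : cancel step_code step_decode.
Proof. by case. Qed.

HB.instance Definition _ := Finite.copy step (can_type step_codeK).

(** A path starting at (0,0) is the sequence of its steps E = (1,0), N = (0,1),
    D = (1,1); [(xcoord p, ycoord p)] is its endpoint. *)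
Definition xcoord (p : seq step) : nat := count_mem StepE p + count_mem StepD p.
Definition ycoord (p : seq step) : nat := count_mem StepN p + count_mem StepD p.

(** Testing the vertices of the path suffices, since a half-plane is convex. *)
Definition weakly_above (alpha : nat) (p : seq step) : bool :=
  [forall i : 'I_(size p).+1,
     alpha * xcoord (take i p) <= ycoord (take i p)].

Definition is_schroder_path (alpha n : nat) (p : seq step) : bool :=
  [&& xcoord p == n, ycoord p == alpha * n & weakly_above alpha p].

(** The bound on the length is not a restriction. *)
Lemma size_schroder_path alpha n p :
  is_schroder_path alpha n p -> size p <= n + alpha * n.
Proof.
case/and3P=> /eqP<- /eqP<- _; rewrite /xcoord /ycoord.
elim: p => //= s p; set b := _ + _ => IH.
apply: (@leq_trans b.+1); first by rewrite ltnS.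
by rewrite /b; case: s => /=; rewrite /eq_op /= !(add0n, add1n, addSn, addnS).
Qed.

Definition schroder_paths (alpha n : nat) : {set (n + alpha * n).-bseq step} :=
  [set p : (n + alpha * n).-bseq step | is_schroder_path alpha n p].

(** A D-step lies on the line y = x iff its starting point does. *)
Definition no_diagonal_D (p : seq step) : bool :=
  [forall i : 'I_(size p),
     (nth StepD p i == StepD) ==> (xcoord (take i p) != ycoord (take i p))].

Definition little_schroder (m : nat) : nat :=
  #|[set p in schroder_paths 1 m | no_diagonal_D p]|.

(** Only the values at j >= 1 are meaningful. *)
Definition sigma (j : nat) : nat := 2 * little_schroder j.-1.

Inductive dyck_step := Up | Down.

Definition is_up (s : dyck_step) : bool := if s is Up then true else false.
Definition dyck_of_bool (b : bool) : dyck_step := if b then Up else Down.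

Lemma is_upK : cancel is_up dyck_of_bool.
Proof. by case. Qed.

HB.instance Definition _ := Finite.copy dyck_step (can_type is_upK).

Definition is_dyck (m : nat) (w : seq dyck_step) : bool :=
  [&& count_mem Up w == m, count_mem Down w == m &
      [forall i : 'I_(size w).+1,
         count_mem Down (take i w) <= count_mem Up (take i w)]].

(** [None] stands for the string [d], and [Some j], with [j : 'I_n] counted from
    0, for the string [u^((a+1)(j+1)) d^(j+1)]. *)
Definition block (a n : nat) (o : option 'I_n) : seq dyck_step :=
  if o is Some j then nseq (a.+1 * j.+1) Up ++ nseq j.+1 Down else [:: Down].

Definition block_concat (a n : nat) (w : seq dyck_step) : bool :=
  [exists bs : (size w).-bseq (option 'I_n),
     w == flatten [seq block a o | o <- bs]].

(** Blocks are nonempty, so the bound on their number is not a restriction. *)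
Lemma block_concatP a n w :
  reflect (exists bs : seq (option 'I_n), w = flatten [seq block a o | o <- bs])
          (block_concat a n w).
Proof.
apply: (iffP existsP) => [[bs /eqP Ew]|[bs Ew]]; first by exists bs.
have le_bs : size bs <= size w.
  rewrite Ew; elim: bs {Ew} => //= o bs IH; rewrite size_cat -add1n leq_add //.
  by case: o.
by exists (Bseq le_bs); rewrite -Ew.
Qed.

(** [ascents_from k w] lists, from left to right, the lengths of the maximal runs
    of up-steps of [u^k w]. *)
Fixpoint ascents_from (k : nat) (w : seq dyck_step) : seq nat :=
  match w with
  | [::] => if k is 0 then [::] else [:: k]
  | Up :: w' => ascents_from k.+1 w'
  | Down :: w' =>
      if k is 0 then ascents_from 0 w' else k :: ascents_from 0 w'
  end.

Definition ascents : seq dyck_step -> seq nat := ascents_from 0.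

Definition dyck_words (a n : nat) : {set (2 * (a.+1 * n)).-tuple dyck_step} :=
  [set w : (2 * (a.+1 * n)).-tuple dyck_step |
     is_dyck (a.+1 * n) w && block_concat a n w].

(** An ascent of length l = (a+1)j receives one of c_j colors, j = l / (a+1). *)
Definition coloring (c : nat -> nat) (a : nat) (w : seq dyck_step) : finType :=
  {dffun forall i : 'I_(size (ascents w)), 'I_(c (nth 0 (ascents w) i %/ a.+1))}.

Definition colored_dyck (c : nat -> nat) (a n : nat) : finType :=
  {w : {w | w \in dyck_words a n} & coloring c a (val w)}.

(* Main.v *)
Require Import Defs.
From mathcomp Require Import all_boot zify.

(** A path whose prefixes contain no more E's than N's is, in a unique way, a
    word in the letter N and in primes, i.e. the path D and the excursions
    N w E with w weakly above y = x.  A prime from (0,0) to (j,j) changes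
    y - alpha x by -(alpha - 1)j, and does not go lower in between because it
    stays above y = x.  So whether a path of slope alpha is a Schroder path only
    depends on the sizes of its primes; replacing N by d and a prime of size j by
    u^(alpha j) d^j, and reversing the order of the factors, yields the Dyck
    words, and the color of an ascent says which of the sigma_j primes of size j
    was used.  That sigma_j = 2 s_(j-1) counts these primes amounts to r_m = 2 s_m
    for m > 0, where r_m counts all Schroder paths; by decomposition at the first
    return, r_(m+1) = r_m + sum r_i r_(m-i) and s_(m+1) = sum r_i s_(m-i), whence
    the claim by induction. *)

(** * Heights along lattice paths *)

(* Height is measured as y - alpha x; [None] means that the path goes below the
   line. *)
Fixpoint final_height (alpha h : nat) (p : seq step) : option nat :=
  match p with
  | [::] => Some h
  | StepN :: p' => final_height alpha h.+1 p'
  | StepE :: p' => if alpha <= h then final_height alpha (h - alpha) p' else None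
  | StepD :: p' => if alpha <= h.+1 then final_height alpha (h.+1 - alpha) p' else None
  end.

Lemma xcoord_cons s p : xcoord (s :: p) = (if s is StepN then 0 else 1) + xcoord p.
Proof. by rewrite /xcoord /=; case: s; rewrite /eq_op /=; lia. Qed.

Lemma ycoord_cons s p : ycoord (s :: p) = (if s is StepE then 0 else 1) + ycoord p.
Proof. by rewrite /ycoord /=; case: s; rewrite /eq_op /=; lia. Qed.

Lemma xcoord_cat p q : xcoord (p ++ q) = xcoord p + xcoord q.
Proof. by rewrite /xcoord !count_cat; lia. Qed.

Lemma ycoord_cat p q : ycoord (p ++ q) = ycoord p + ycoord q.
Proof. by rewrite /ycoord !count_cat; lia. Qed.

Lemma forall_ord_iota n (P : pred nat) :
  [forall i : 'I_n, P i] = all P (iota 0 n).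
Proof.
apply/forallP/allP => [H i|H i]; last by apply: H; rewrite mem_iota ltn_ord.
by rewrite mem_iota => /= lt_in; have := H (Ordinal lt_in).
Qed.

Lemma final_height_cat alpha h p q :
  final_height alpha h (p ++ q) =
  obind (fun k => final_height alpha k q) (final_height alpha h p).
Proof. by elim: p h => [|[] p IH] h //=; case: ifP. Qed.

Lemma final_height_coord alpha h k p :
  final_height alpha h p = Some k -> h + ycoord p = k + alpha * xcoord p.
Proof.
elim: p h => [|s p IH] h; first by case=> ->; rewrite muln0.
rewrite xcoord_cons ycoord_cons mulnDr.
case: s => /=; try case: ifP => // le_ah;
  by move/IH; lia.
Qed.

Lemma final_heightP alpha h p :
  reflect (forall i, i <= size p ->
             alpha * xcoord (take i p) <= h + ycoord (take i p))
          (final_height alpha h p).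
Proof.
apply: (iffP idP) => [|H].
  elim: p h => [|s p IH] h Hh [|i] //= le_i; rewrite ?muln0 //.
  rewrite xcoord_cons ycoord_cons mulnDr.
  by case: s Hh => /=; try case: ifP => // le_ah;
    move=> /IH/(_ _ le_i); lia.
elim: p h H => //= s p IH h H.
have Hs i : i <= size p -> alpha * xcoord (s :: take i p) <= h + ycoord (s :: take i p).
  exact: (H i.+1).
have := Hs 0 isT; rewrite take0 xcoord_cons ycoord_cons mulnDr !addn0 muln0.
by case: s Hs {H} => Hs /= le_h; rewrite ?ifT; try (by lia); apply: IH => i /Hs;
  rewrite xcoord_cons ycoord_cons mulnDr; lia.
Qed.

(** By [final_height_coord], the final height is the value of y - alpha x at the endpoint, so being
    0 encodes the condition on the ordinate. *)
Lemma is_schroder_pathE alpha n p :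
  is_schroder_path alpha n p =
  (xcoord p == n) && (final_height alpha 0 p == Some 0).
Proof.
rewrite /is_schroder_path; case: eqP => //= <- {n}.
rewrite (_ : weakly_above alpha p = final_height alpha 0 p).
  case Ep: final_height => [k|]; last by rewrite andbF.
  by rewrite andbT -[ycoord p]add0n (final_height_coord _ _ _ _ Ep) -{2}[_ * _]add0n eqn_add2r.
apply/forallP/final_heightP => [H i le_i|H i]; first exact: (H (Ordinal (le_i : i < _.+1))).
by apply: H; rewrite -ltnS.
Qed.

(* A path weakly above y = x drops below its starting height by at most the
   final drop when heights are measured along slope a + 1. *)
Lemma final_height_slope a g h k p :
  final_height 1 g p = Some k -> a * xcoord p <= h ->
  final_height a.+1 (h + g) p = Some (h - a * xcoord p + k).
Proof.
elim: p g h => [|s p IH] g h; first by case=> ->; rewrite muln0 subn0.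
rewrite xcoord_cons mulnDr; case: s => /=; rewrite ?muln1 ?muln0.
- case: ifP => // g_gt0 /IH{}IH le_h; rewrite ifT; last by lia.
  have /IH E : a * xcoord p <= h - a by lia.
  by rewrite (_ : _ - _ = h - a + (g - 1)) ?E; [congr Some|]; lia.
- by move=> /IH{}IH le_h; rewrite -addnS IH.
- rewrite subn1 /= => /IH{}IH le_h; rewrite ifT; last by lia.
  have /IH E : a * xcoord p <= h - a by lia.
  by rewrite (_ : _ - _ = h - a + g) ?E; [congr Some|]; lia.
Qed.

Lemma final_height1_add g h k p :
  final_height 1 g p = Some k -> final_height 1 (h + g) p = Some (h + k).
Proof. by move=> /(@final_height_slope 0 g h) ->; rewrite ?mul0n ?subn0. Qed.

(** * First returns to the diagonal *)

(** Along slope 1 only E loses height, one unit at a time, so the first failure is an E taken at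
    height 0; [w] is what precedes it. *)
Lemma first_return_split h p : final_height 1 h p = None ->
  exists w q, p = w ++ StepE :: q /\ final_height 1 h w = Some 0.
Proof.
elim: p h => [|[] p IH] h //=.
- case: h => [|h] /=; first by move=> _; exists [::], p.
  rewrite subn1 => /IH[w [q [-> Ew]]]; exists (StepE :: w), q.
  by rewrite /= subn1.
- by move=> /IH[w [q [-> Ew]]]; exists (StepN :: w), q.
- rewrite subn1 => /IH[w [q [-> Ew]]]; exists (StepD :: w), q.
  by rewrite /= subn1.
Qed.

(** The E after [w] is the first step to go below the line, which the word determines. *)
Lemma first_return_inj h w w' q q' :
  final_height 1 h w = Some 0 -> final_height 1 h w' = Some 0 ->
  w ++ StepE :: q = w' ++ StepE :: q' -> w = w' /\ q = q'.
Proof.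
elim: w w' h => [|s w IH] [|s' w'] h /=.
- by move=> _ _ [].
- by case=> -> + [Es _]; rewrite -Es.
- by move=> /[swap] [[->]] + [Es _]; rewrite Es.
move=> Ew Ew' [Es]; rewrite -{}Es in Ew' *.
by case: s Ew Ew' => /=; do ?case: ifP => // _; move=> Ew Ew' /(IH _ _ Ew Ew')[-> ->].
Qed.

Lemma final_height_first_return w q : final_height 1 0 w = Some 0 ->
  final_height 1 0 (StepN :: w ++ StepE :: q) = final_height 1 0 q.
Proof. by move=> Ew /=; rewrite final_height_cat (final_height1_add _ 1 _ _ Ew). Qed.

Lemma xcoord_first_return w q :
  xcoord (StepN :: w ++ StepE :: q) = (xcoord w + xcoord q).+1.
Proof. by rewrite xcoord_cons xcoord_cat xcoord_cons /=; lia. Qed.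

(** * Recurrences for the large and little Schroder numbers *)

(* Unlike [schroder_paths], paths of different sizes share a type. *)
Definition schroder_seqs alpha m : seq (seq step) :=
  [seq val p | p <- enum (schroder_paths alpha m)].

Lemma size_schroder_seqs alpha m :
  size (schroder_seqs alpha m) = #|schroder_paths alpha m|.
Proof. by rewrite size_map cardE. Qed.

Lemma uniq_schroder_seqs alpha m : uniq (schroder_seqs alpha m).
Proof. by rewrite map_inj_uniq ?enum_uniq //; apply: val_inj. Qed.

Lemma mem_schroder_seqs alpha m p :
  (p \in schroder_seqs alpha m) = is_schroder_path alpha m p.
Proof.
apply/mapP/idP => [[q + ->]|Sp]; first by rewrite mem_enum inE.
by exists (Bseq (size_schroder_path Sp)); rewrite // mem_enum inE.
Qed.

(** All interior vertices of N w E satisfy y > x, so no D of [w] lies on the diagonal. The excursion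
    ends on the diagonal, so the tests on [q] are unaffected by the shift. *)
Lemma no_diagonal_D_first_return w q : final_height 1 0 w = Some 0 ->
  no_diagonal_D (StepN :: w ++ StepE :: q) = no_diagonal_D q.
Proof.
move=> Ew; rewrite /no_diagonal_D.
pose bad p i := (nth StepD p i == StepD) ==> (xcoord (take i p) != ycoord (take i p)).
rewrite (forall_ord_iota _ (bad _)) [RHS](forall_ord_iota _ (bad _)).
have -> : size (StepN :: w ++ StepE :: q) = (size w).+2 + size q.
  by rewrite /= size_cat /=; lia.
have Ey := final_height_coord _ _ _ _ Ew; rewrite !add0n mul1n in Ey.
rewrite iotaD all_cat [X in X && _](introT allP); last first.
  move=> [|i]; first by [].
  rewrite mem_iota => lt_i; rewrite /bad /= nth_cat take_cat.
  case: ltnP => le_i.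
    rewrite xcoord_cons ycoord_cons add0n; apply/implyP=> _.
    have /final_heightP/(_ i (ltnW le_i)) : final_height 1 0 w by rewrite Ew.
    by lia.
  (* Here [i = size w], the position of the closing E. *)
  by rewrite (_ : i - size w = 0) //; lia.
rewrite andTb add0n -[X in iota X _]addn0 iotaDl all_map; apply: eq_all => i /=.
rewrite /bad /= nth_cat take_cat ltnNge ltnW ?ltnS ?leq_addr //=.
rewrite (_ : (size w + i).+1 - size w = i.+1) /=; last by lia.
rewrite xcoord_first_return ycoord_cons ycoord_cat ycoord_cons Ey.
by congr (_ ==> ~~ _); lia.
Qed.

Lemma uniq_flatten_map (T U : eqType) (F : T -> seq U) s :
  uniq s -> (forall x, x \in s -> uniq (F x)) ->
  (forall x y z, x \in s -> y \in s -> z \in F x -> z \in F y -> x = y) ->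
  uniq (flatten [seq F x | x <- s]).
Proof.
elim: s => //= x s IH /andP[xNs Us] UF FI.
rewrite cat_uniq UF ?mem_head // IH ?andbT //.
- apply/hasPn => z /flatten_mapP[y ys zy]; apply: contra xNs => zx.
  by rewrite (FI x y z) ?mem_head // in_cons ys orbT.
- by move=> y ys; apply: UF; rewrite in_cons ys orbT.
- by move=> y y' z ys y's; apply: FI; rewrite in_cons ?ys ?y's orbT.
Qed.

Lemma count_allpairs (T1 T2 U : eqType) (f : T1 -> T2 -> U) s t (P : pred U) (Q : pred T2) :
  (forall x y, x \in s -> P (f x y) = Q y) ->
  count P [seq f x y | x <- s, y <- t] = size s * count Q t.
Proof.
elim: s => //= x s IH PQ; rewrite count_cat IH ?mulSn => [|? y ys].
  by congr addn; rewrite count_map; apply: eq_count => y /=; rewrite PQ ?mem_head.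
by rewrite PQ // in_cons ys orbT.
Qed.

Lemma mem_schroder_seqs1 m p :
  (p \in schroder_seqs 1 m) = (xcoord p == m) && (final_height 1 0 p == Some 0).
Proof. by rewrite mem_schroder_seqs is_schroder_pathE. Qed.

(** A nonempty path starts with D or with an N closed by the E of the first return;
    [first_return_inj] makes the splitting unique. *)
Lemma schroder_seqs1S m :
  perm_eq (schroder_seqs 1 m.+1)
    ([seq StepD :: p | p <- schroder_seqs 1 m] ++
     flatten [seq [seq StepN :: w ++ StepE :: q
                     | w <- schroder_seqs 1 i, q <- schroder_seqs 1 (m - i)]
               | i <- iota 0 m.+1]).
Proof.
apply: uniq_perm; first exact: uniq_schroder_seqs.
  rewrite cat_uniq map_inj_uniq ?uniq_schroder_seqs ?andTb; last by move=> ? ? [].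
  apply/andP; split.
    apply/hasPn => z /flatten_mapP[i _ /allpairsP[[w q] [_ _ ->]]].
    by apply/mapP => -[].
  apply: uniq_flatten_map => [|i _|i j z _ _]; first exact: iota_uniq.
    apply: allpairs_uniq; rewrite ?uniq_schroder_seqs // => -[w q] [w' q'].
    move=> /allpairsP[[? ?] [/= + _ [-> ->]]] /allpairsP[[? ?] [/= + _ [-> ->]]].
    rewrite !mem_schroder_seqs1 => /andP[_ /eqP Ew] /andP[_ /eqP Ew'] [].
    by move=> /(first_return_inj _ _ _ _ _ Ew Ew') [-> ->].
  move=> /allpairsP[[w q] [/= + _ ->]] /allpairsP[[w' q'] [/= + _ [+]]].
  rewrite !mem_schroder_seqs1 => /andP[/eqP<- /eqP Ew] /andP[/eqP<- /eqP Ew'].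
  by move=> /(first_return_inj _ _ _ _ _ Ew Ew') [-> _].
move=> p; rewrite mem_cat mem_schroder_seqs1; apply/andP/orP.
  case: p => [|[] p] [/eqP Ex /eqP Ep]; rewrite ?xcoord_cons in Ex.
  - by [].
  - by [].
  - right; have [|w [q [Ep' Ew]]] := first_return_split 0 p.
      (* If [p] never went below its own start, the whole path would end at height [k.+1] instead of
         0. *)
      case E0: (final_height 1 0 p) => [k|] //.
      by move: Ep; rewrite /= (final_height1_add _ 1 _ _ E0).
    rewrite Ep' xcoord_cat xcoord_cons add0n in Ex *.
    apply/flatten_mapP; exists (xcoord w); first by rewrite mem_iota; lia.
    apply/allpairsP; exists (w, q); split=> //=; rewrite mem_schroder_seqs1.
      by rewrite Ew !eqxx.
    rewrite -(final_height_first_return w q Ew) -Ep' Ep eqxx andbT; lia.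
  - left; apply/mapP; exists p; rewrite ?mem_schroder_seqs1 //.
    by move: Ep; rewrite /= subn1 => ->; rewrite eqxx andbT; lia.
case=> [/mapP[q + ->]|/flatten_mapP[i + /allpairsP[[w q] [/= + + ->]]]].
  rewrite mem_schroder_seqs1 => /andP[/eqP<- /eqP Eq].
  by rewrite xcoord_cons /= subn1 Eq.
rewrite mem_iota !mem_schroder_seqs1 => lt_i /andP[/eqP Ei /eqP Ew] /andP[/eqP Ej /eqP Eq].
rewrite xcoord_first_return final_height_first_return // Eq; split=> //; lia.
Qed.

(** A general [Q] yields both recurrences: [predT] counts all paths, while [no_diagonal_D] kills the
    term of the paths starting with D. *)
Lemma count_schroder_seqs1S (Q : pred (seq step)) m :
  (forall w q, final_height 1 0 w = Some 0 -> Q (StepN :: w ++ StepE :: q) = Q q) ->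
  count Q (schroder_seqs 1 m.+1) =
  count (fun p => Q (StepD :: p)) (schroder_seqs 1 m) +
  \sum_(i < m.+1) size (schroder_seqs 1 i) * count Q (schroder_seqs 1 (m - i)).
Proof.
move=> HQ; rewrite (permP (schroder_seqs1S m)) count_cat count_map; congr addn.
rewrite count_flatten -map_comp sumnE big_map -[iota _ _]/(index_iota 0 m.+1).
rewrite big_mkord; apply: eq_bigr => i _; apply: count_allpairs => w q.
by rewrite mem_schroder_seqs1 => /andP[_ /eqP]; apply: HQ.
Qed.

Lemma count_schroder_seqs10 (Q : pred (seq step)) :
  count Q (schroder_seqs 1 0) = Q [::].
Proof.
suff /permP-> : perm_eq (schroder_seqs 1 0) [:: [::]] by rewrite /= addn0.
apply: uniq_perm => // [|p]; first exact: uniq_schroder_seqs.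
rewrite mem_schroder_seqs1 in_cons orbF; apply/idP/eqP => [/andP[Ex /eqP Ep]|-> //].
have := final_height_coord _ _ _ _ Ep.
by case: p Ex {Ep} => // s p; rewrite xcoord_cons ycoord_cons; case: s; lia.
Qed.

Lemma little_schroderE m :
  little_schroder m = count no_diagonal_D (schroder_seqs 1 m).
Proof.
rewrite /little_schroder /schroder_seqs count_map cardE -size_filter.
rewrite /enum_mem -filter_predI; congr size; apply: eq_filter => p /=.
by rewrite !inE andbC.
Qed.

(** The term [m == 0] accounts for the prime D: there is one empty path, but 2 s_0 = 2. *)
Lemma large_schroderE m :
  (m == 0) + #|schroder_paths 1 m| = 2 * little_schroder m.
Proof.
rewrite -size_schroder_seqs little_schroderE -count_predT.
have [n le_m] := ubnP m; elim: n => // n IH in m le_m *.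
case: m le_m => [|m] le_m.
  by rewrite !count_schroder_seqs10 /no_diagonal_D (introT forallP) // => -[].
rewrite !count_schroder_seqs1S //; last exact: no_diagonal_D_first_return.
have D_start p : no_diagonal_D (StepD :: p) = false.
  by rewrite /no_diagonal_D; apply/negbTE/forallPn; exists ord0.
rewrite (eq_count D_start) count_pred0.
(* The summand i = m is isolated: as s_0 = 1, its double 2 r_m matches r_m r_0 plus the r_m paths
   starting with D. The other summands have m - i > 0, where the induction hypothesis reads r = 2
   s. *)
rewrite !add0n !big_ord_recr /= subnn !mulnDr big_distrr /=.
rewrite [X in _ = _ + 2 * (_ * X)](_ : _ = 1); last first.
  by rewrite count_schroder_seqs10 /no_diagonal_D (introT forallP) // => -[].
rewrite (eq_bigr (fun i : 'I_m => 2 * (size (schroder_seqs 1 i) *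
    count no_diagonal_D (schroder_seqs 1 (m - i))))).
  rewrite !count_schroder_seqs10 /= !count_predT; lia.
move=> i _; rewrite mulnCA -IH; last by lia.
by rewrite (_ : (m - i == 0) = false) //; have := ltn_ord i; lia.
Qed.

(** * Primes and their effect on heights *)

(* The primes of size j.+1. *)
Definition prime_seqs j : seq (seq step) :=
  nseq (j == 0) [:: StepD] ++
  [seq StepN :: rcons w StepE | w <- schroder_seqs 1 j].

Lemma size_prime_seqs j : size (prime_seqs j) = sigma j.+1.
Proof.
by rewrite size_cat size_nseq size_map size_schroder_seqs large_schroderE.
Qed.

Lemma mem_prime_seqs j q : q \in prime_seqs j ->
  (q = [:: StepD] /\ j = 0) \/
  exists w, [/\ q = StepN :: rcons w StepE, final_height 1 0 w = Some 0 & xcoord w = j].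
Proof.
rewrite mem_cat => /orP[|/mapP[w + ->]].
  by rewrite mem_nseq => /andP[+ /eqP->]; case: j => // _; left.
by rewrite mem_schroder_seqs1 => /andP[/eqP Ex /eqP Ew]; right; exists w.
Qed.

Lemma uniq_prime_seqs j : uniq (prime_seqs j).
Proof.
rewrite cat_uniq map_inj_uniq ?uniq_schroder_seqs ?andbT => [|w w' [/rcons_inj[]]] //.
apply/andP; split; first by case: j.
by apply/hasPn => q /mapP[w _ ->]; rewrite mem_nseq andbC.
Qed.

Lemma prime_seqs_balanced j q : q \in prime_seqs j ->
  final_height 1 0 q = Some 0 /\ xcoord q = j.+1.
Proof.
case/mem_prime_seqs => [[-> ->] //|[w [-> Ew <-]]]; rewrite -cats1.
by rewrite final_height_first_return // xcoord_first_return addn0.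
Qed.

(** By [final_height_slope], the net loss of a prime is also its greatest loss. If it exceeds [h],
    [final_height_coord] rules out any final height. *)
Lemma final_height_prime a h j q p : q \in prime_seqs j ->
  final_height a.+1 h (q ++ p) =
  if a * j.+1 <= h then final_height a.+1 (h - a * j.+1) p else None.
Proof.
case/prime_seqs_balanced=> Eq Ex; rewrite final_height_cat -Ex.
case: leqP => [le_h|lt_h].
  by have := @final_height_slope a 0 h 0 q Eq le_h; rewrite !addn0 => ->.
case E: final_height => [k|] //=.
have := final_height_coord _ _ _ _ E; have := final_height_coord _ _ _ _ Eq; lia.
Qed.

(** The primes form a prefix code: D is known by its first letter, and N w E ends at the first
    return. *)
Lemma prime_seqs_cat_inj j j' q q' p p' :
  q \in prime_seqs j -> q' \in prime_seqs j' -> q ++ p = q' ++ p' ->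
  q = q' /\ p = p'.
Proof.
case/mem_prime_seqs=> [[-> _]|[w [-> Ew _]]];
case/mem_prime_seqs=> [[-> _]|[w' [-> Ew' _]]] //=; first by case.
rewrite !cat_rcons => -[/(first_return_inj _ _ _ _ _ Ew Ew')[-> ->]] //.
Qed.

(** * Unique factorization into N's and primes *)

(* A shape records the factors of a path: [None] stands for N and [Some j] for a
   prime of size j.+1, so that reversed shapes match the lists of blocks. *)
Fixpoint paths_of_shape n (bs : seq (option 'I_n)) : seq (seq step) :=
  match bs with
  | [::] => [:: [::]]
  | None :: bs' => [seq StepN :: p | p <- paths_of_shape n bs']
  | Some j :: bs' => [seq q ++ p | q <- prime_seqs j, p <- paths_of_shape n bs']
  end.

Definition shape_weight n (bs : seq (option 'I_n)) : nat :=
  \sum_(o <- bs) if o is Some j then j.+1 else 0.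

Fixpoint shape_height a n h (bs : seq (option 'I_n)) : option nat :=
  match bs with
  | [::] => Some h
  | None :: bs' => shape_height a n h.+1 bs'
  | Some j :: bs' =>
      if a * j.+1 <= h then shape_height a n (h - a * j.+1) bs' else None
  end.

Lemma size_paths_of_shape n bs :
  size (paths_of_shape n bs) = \prod_(o <- bs) if o is Some j then sigma j.+1 else 1.
Proof.
elim: bs => [|[j|] bs IH] /=; rewrite ?big_nil ?big_cons //.
  by rewrite size_allpairs IH size_prime_seqs.
by rewrite size_map mul1n.
Qed.

Lemma final_height_shape a n h bs p : p \in paths_of_shape n bs ->
  final_height a.+1 h p = shape_height a n h bs.
Proof.
elim: bs p h => [|[j|] bs IH] p h /=.
- by rewrite in_cons orbF => /eqP->.
- case/allpairsP=> -[q p'] [/= Pq Pp ->]; rewrite (final_height_prime _ _ _ _ _ Pq).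
  by rewrite (IH _ _ Pp).
- by case/mapP=> p' /IH E ->; apply: E.
Qed.

Lemma xcoord_shape n bs p : p \in paths_of_shape n bs -> xcoord p = shape_weight n bs.
Proof.
rewrite /shape_weight; elim: bs p => [|[j|] bs IH] p /=; rewrite ?big_nil ?big_cons.
- by rewrite in_cons orbF => /eqP->.
- case/allpairsP=> -[q p'] [/= /prime_seqs_balanced[_ Ex] /IH Ep ->].
  by rewrite xcoord_cat Ex Ep.
- by case/mapP=> p' /IH E ->; rewrite xcoord_cons E.
Qed.

(** With a = 0, that is along y = x, primes lose no height. Hence a product of factors cannot go
    below its start, which tells a factor N from the first letter of a prime. *)
Lemma shape_height0 n h bs : shape_height 0 n h bs.
Proof. by elim: bs h => [|[j|] bs IH] h //=; rewrite mul0n. Qed.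

Lemma paths_of_shape_inj n bs bs' p :
  p \in paths_of_shape n bs -> p \in paths_of_shape n bs' -> bs = bs'.
Proof.
(* After the N of a prime N w E, the remainder goes below its start at the closing E, so it cannot
   be a product of factors. *)
have prime_neq_N j q p1 p2 cs : q \in prime_seqs j -> p2 \in paths_of_shape n cs ->
    q ++ p1 <> StepN :: p2.
  case/mem_prime_seqs=> [[-> _]|[w [-> Ew _]]] // /(final_height_shape 0 n 0) + /= [Ep].
  rewrite -Ep cat_rcons final_height_cat Ew /= => E.
  by have := shape_height0 n 0 cs; rewrite -E.
elim: bs bs' p => [|[j|] bs IH] [|[j'|] bs'] p //=.
- rewrite in_cons orbF => /eqP-> /allpairsP[[q p'] [/= /prime_seqs_balanced[_ Ex] _ E]].
  by case: q Ex E.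
- by rewrite in_cons orbF => /eqP-> /mapP[].
- move=> /allpairsP[[q p'] [/= /prime_seqs_balanced[_ Ex] _ ->]].
  by case: q Ex.
- move=> /allpairsP[[q1 p1] [/= Pq1 Pp1 ->]] /allpairsP[[q2 p2] [/= Pq2 Pp2]].
  case/(prime_seqs_cat_inj _ _ _ _ _ _ Pq1 Pq2) => Eq Ep.
  rewrite -Ep in Pp2; rewrite (IH _ _ Pp1 Pp2); congr (Some _ :: _).
  (* The index of a prime is read off from its abscissa. *)
  apply: val_inj => /=; apply: succn_inj.
  by rewrite -(proj2 (prime_seqs_balanced _ _ Pq1)) Eq (proj2 (prime_seqs_balanced _ _ Pq2)).
- move=> /allpairsP[[q1 p1] [/= Pq1 _ ->]] /mapP[p2 Pp2 E].
  by case: (prime_neq_N _ _ _ _ _ Pq1 Pp2 E).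
- by move=> /mapP[p1 _ ->].
- move=> /mapP[p2 Pp2 ->] /allpairsP[[q1 p1] [/= Pq1 _ E]].
  by case: (prime_neq_N _ _ _ _ _ Pq1 Pp2 (esym E)).
- by move=> /mapP[p1 Pp1 ->] /mapP[p2 Pp2 [E]]; rewrite -E in Pp2; rewrite (IH _ _ Pp1 Pp2).
Qed.

Lemma uniq_paths_of_shape n bs : uniq (paths_of_shape n bs).
Proof.
elim: bs => [|[j|] bs IH] //=; last by rewrite map_inj_uniq // => ? ? [].
apply: allpairs_uniq; rewrite ?uniq_prime_seqs // => -[q p] [q' p'].
move=> /allpairsP[[? ?] [/= Pq _ [-> ->]]] /allpairsP[[? ?] [/= Pq' _ [-> ->]]].
by case/(prime_seqs_cat_inj _ _ _ _ _ _ Pq Pq') => -> ->.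
Qed.

(** Factors are split off from the left: an initial N stands alone if the rest never goes below its
    own start, and otherwise opens a prime closed at the first return. The bound on the abscissa
    makes the sizes fit into ['I_n]. *)
Lemma paths_of_shape_exist n p : final_height 1 0 p -> xcoord p <= n ->
  exists bs, p \in paths_of_shape n bs.
Proof.
have [m] := ubnP (size p); elim: m p => // m IH [|[] p] /= lt_m Hp le_n.
- by exists [::].
- by [].
- rewrite xcoord_cons /= in le_n.
  case E0: (final_height 1 0 p) => [k|].
    have [|||bs Hbs] := IH p; rewrite ?E0 //.
    by exists (None :: bs); apply: map_f.
  have [w [q [Ep Ew]]] := first_return_split 0 p E0.
  rewrite Ep size_cat xcoord_cat xcoord_cons /= in lt_m le_n Hp *.
  have [|||bs Hbs] := IH q; try lia.
    by rewrite -(final_height_first_return w q Ew).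
  have lt_w : xcoord w < n by lia.
  exists (Some (Ordinal lt_w) :: bs) => /=; rewrite -cat_rcons -cat_cons.
  apply: allpairs_f => //; rewrite mem_cat; apply/orP; right.
  by apply: (map_f (fun w => StepN :: rcons w StepE)); rewrite mem_schroder_seqs1 Ew !eqxx.
- rewrite subn1 /= in Hp; rewrite xcoord_cons /= in le_n.
  have [|||bs Hbs] := IH p; try solve [done | lia].
  have n_gt0 : 0 < n by lia.
  exists (Some (Ordinal n_gt0) :: bs).
  exact: (@allpairs_f _ _ _ cat (prime_seqs 0) _ [:: StepD] p).
Qed.

Lemma shape_height_cat a n h bs bs' :
  shape_height a n h (bs ++ bs') =
  obind (fun k => shape_height a n k bs') (shape_height a n h bs).
Proof. by elim: bs h => [|[j|] bs IH] h //=; case: ifP. Qed.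

(** * Dyck words as concatenations of blocks *)

Fixpoint dyck_height (h : nat) (w : seq dyck_step) : option nat :=
  match w with
  | [::] => Some h
  | Up :: w' => dyck_height h.+1 w'
  | Down :: w' => if h is h'.+1 then dyck_height h' w' else None
  end.

Lemma count_Up_cons s w : count_mem Up (s :: w) = is_up s + count_mem Up w.
Proof. by case: s. Qed.

Lemma count_Down_cons s w : count_mem Down (s :: w) = ~~ is_up s + count_mem Down w.
Proof. by case: s. Qed.

Lemma dyck_height_count h k w :
  dyck_height h w = Some k -> h + count_mem Up w = k + count_mem Down w.
Proof.
elim: w h => [|s w IH] h; first by case=> ->.
rewrite count_Up_cons count_Down_cons.
by case: s => /=; last case: h => // h; move=> /IH; rewrite ?add1n ?addnS ?addSn => ->.
Qed.

Lemma dyck_heightP h w :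
  reflect (forall i, i <= size w ->
             count_mem Down (take i w) <= h + count_mem Up (take i w))
          (dyck_height h w).
Proof.
apply: (iffP idP) => [|H].
  elim: w h => [|s w IH] h Hh [|i] // le_i.
  rewrite [take _ _]/= count_Up_cons count_Down_cons.
  by case: s Hh le_i => /=; last case: h => // h; move=> /IH H le_i;
    have := H _ le_i; rewrite ?add0n ?add1n ?addSn ?ltnS ?addnS.
elim: w h H => //= s w IH h H.
have Hs i : i <= size w ->
    count_mem Down (s :: take i w) <= h + count_mem Up (s :: take i w).
  exact: (H i.+1).
have := Hs 0 isT; rewrite take0 count_Up_cons count_Down_cons.
case: s Hs {H} => Hs le_h; last case: h le_h Hs => // h _ Hs;
  by apply: IH => i /Hs; rewrite count_Up_cons count_Down_cons
    ?add0n ?add1n ?addSn ?ltnS ?addnS.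
Qed.

Lemma is_dyckE m w :
  is_dyck m w = (count_mem Up w == m) && (dyck_height 0 w == Some 0).
Proof.
rewrite /is_dyck; case: eqP => //= <- {m}.
rewrite (_ : [forall i, _] = dyck_height 0 w); last first.
  apply/forallP/dyck_heightP => [H i le_i|H i]; first exact: (H (Ordinal (le_i : i < _.+1))).
  by apply: H; rewrite -ltnS.
case Ew: dyck_height => [k|]; last by rewrite andbF.
rewrite andbT -[count_mem Up w]add0n (dyck_height_count _ _ _ Ew).
by rewrite -{1}[count_mem Down w]add0n eqn_add2r eq_sym.
Qed.

Definition shape_word a n (bs : seq (option 'I_n)) : seq dyck_step :=
  flatten [seq block a o | o <- bs].

Lemma dyck_height_Ups h k w : dyck_height h (nseq k Up ++ w) = dyck_height (h + k) w.
Proof. by elim: k h => [|k IH] h /=; rewrite ?addn0 // IH addnS. Qed.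

Lemma dyck_height_Downs h k w : dyck_height (h + k) (nseq k Down ++ w) = dyck_height h w.
Proof. by elim: k => [|k IH] /=; rewrite ?addn0 // addnS. Qed.

Lemma dyck_height_block a n h (j : 'I_n) w :
  dyck_height h (block a (Some j) ++ w) = dyck_height (h + a * j.+1) w.
Proof.
rewrite /block -catA dyck_height_Ups mulSn addnCA addnC.
by rewrite dyck_height_Downs.
Qed.

(** The two walks visit the same heights in opposite order: a lone Down undoes an N, and a block
    with index [j] regains the [a * j.+1] lost by the prime. This is why the shape is reversed. *)
Lemma dyck_height_shape_word a n h k bs :
  dyck_height h (shape_word a n bs) = Some k <-> shape_height a n k (rev bs) = Some h.
Proof.
elim: bs h => [|o bs IH] h; first by split=> -[->].
rewrite rev_cons -cats1 shape_height_cat.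
rewrite -[shape_word _ _ _]/(block a o ++ shape_word a n bs).
case: o => [j|].
  rewrite dyck_height_block IH; split=> [->|] /=; first by rewrite leq_addl addnK.
  by case: shape_height => //= x; case: ifP => // le_x [<-]; rewrite subnK.
case: h => [|h]; last by rewrite IH; split=> [->|] //; case: shape_height => //= x [->].
(* At h = 0 both sides fail: Down is not allowed, and no N ends at height 0. *)
by split=> //; case: shape_height.
Qed.

Lemma count_Up_shape_word a n bs :
  count_mem Up (shape_word a n bs) = a.+1 * shape_weight n bs.
Proof.
rewrite /shape_word /shape_weight; elim: bs => [|o bs IH] /=.
  by rewrite big_nil muln0.
rewrite count_cat IH big_cons mulnDr; congr addn.
case: o => [j|]; last by rewrite muln0.
rewrite /block count_cat !count_nseq.
exact: etrans (addn0 _) (mul1n _).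
Qed.

Lemma is_dyck_shape_word a n bs :
  is_dyck (a.+1 * n) (shape_word a n bs) =
  (shape_weight n bs == n) && (shape_height a n 0 (rev bs) == Some 0).
Proof.
rewrite is_dyckE count_Up_shape_word eqn_pmul2l //; congr andb.
by apply/eqP/eqP; rewrite dyck_height_shape_word.
Qed.

Lemma Ups_Down_inj k k' w w' :
  nseq k Up ++ Down :: w = nseq k' Up ++ Down :: w' -> k = k' /\ w = w'.
Proof. by elim: k k' => [|k IH] [|k'] //= [] // /IH[-> ->]. Qed.

(** Every nonempty run of Ups in a block is followed by a Down, so the number of leading Ups
    determines the first block. *)
Lemma shape_word_inj a n : injective (shape_word a n).
Proof.
rewrite /shape_word; elim=> [|o bs IH] [|o' bs'] //=.
- by case: o'.
- by case: o.
case: o o' => [j|] [j'|] //=; last by case=> /IH->.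
rewrite -!catA => E.
have [/eqP] := Ups_Down_inj (a.+1 * j.+1) (a.+1 * j'.+1) 
  (nseq j Down ++ _) (nseq j' Down ++ _) E.
rewrite eqn_pmul2l // eqSS => /eqP/val_inj-> /eqP.
by rewrite eqseq_cat // eqxx => /eqP/IH->.
Qed.

(** * Ascents and their colorings *)

(** Each block ends with Down, so the Ups of different blocks never merge into one ascent. *)
Lemma ascents_shape_word a n bs :
  ascents (shape_word a n bs) = pmap (omap (fun j : 'I_n => a.+1 * j.+1)) bs.
Proof.
have Ups h k w : ascents_from h (nseq k Up ++ w) = ascents_from (h + k) w.
  by elim: k h => [|k IH] h /=; rewrite ?addn0 // IH addnS.
have Downs k w : ascents_from 0 (nseq k Down ++ w) = ascents_from 0 w.
  by elim: k => [|k IH] /=.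
have blockE (j : 'I_n) w : ascents_from 0 (block a (Some j) ++ w) =
    a.+1 * j.+1 :: ascents_from 0 w.
  by rewrite /block -catA Ups add0n mulSn addSn /= Downs.
rewrite /ascents /shape_word; elim: bs => [|o bs IH] //.
rewrite -[flatten _]/(block a o ++ flatten [seq block a o | o <- bs]).
by case: o => [j|] //; rewrite blockE IH.
Qed.

Lemma card_coloring c a w :
  #|coloring c a w| = \prod_(l <- ascents w) c (l %/ a.+1).
Proof.
rewrite card_dep_ffun foldrE big_map big_enum /= (big_nth 0) big_mkord.
by apply: eq_bigr => i _; rewrite card_ord.
Qed.

Lemma prod_ascents_shape_word c a n bs :
  \prod_(l <- ascents (shape_word a n bs)) c (l %/ a.+1) =
  \prod_(o <- bs) if o is Some j then c j.+1 else 1.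
Proof.
rewrite ascents_shape_word; elim: bs => [|[j|] bs IH] /=; rewrite ?big_nil ?big_cons //.
  by rewrite IH mulKn.
by rewrite IH mul1n.
Qed.

(** * Comparison of the two families through shapes *)

(** The length bound loses nothing: blocks are nonempty, so there are at most as many as letters in
    the Dyck word. *)
Definition dyck_shapes a n : seq (seq (option 'I_n)) :=
  [seq val bs | bs <- enum
    [set bs : (2 * (a.+1 * n)).-bseq (option 'I_n) |
       (shape_weight n bs == n) && (shape_height a n 0 (rev bs) == Some 0)]].

Lemma size_dyck m w : is_dyck m w -> size w = 2 * m.
Proof.
case/and3P=> /eqP Eu /eqP Ed _; rewrite mul2n -addnn -{1}Eu -Ed.
rewrite -(count_predC (pred1 Up)); congr addn; apply: eq_count.
by case.
Qed.

Lemma mem_dyck_shapes a n bs :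
  (bs \in dyck_shapes a n) =
  (shape_weight n bs == n) && (shape_height a n 0 (rev bs) == Some 0).
Proof.
apply/mapP/idP => [[cs + ->]|Hbs]; first by rewrite mem_enum inE.
have le_bs : size bs <= 2 * (a.+1 * n).
  have := Hbs; rewrite -is_dyck_shape_word => /size_dyck <-.
  rewrite /shape_word; elim: (bs) => //= o cs IH; rewrite size_cat -add1n leq_add //.
  by case: o.
by exists (Bseq le_bs); rewrite // mem_enum inE.
Qed.

Lemma uniq_dyck_shapes a n : uniq (dyck_shapes a n).
Proof. by rewrite map_inj_uniq ?enum_uniq //; apply: val_inj. Qed.

Lemma dyck_words_shapes a n :
  perm_eq [seq val w | w <- enum (dyck_words a n)]
          [seq shape_word a n bs | bs <- dyck_shapes a n].
Proof.
apply: uniq_perm.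
- by rewrite map_inj_uniq ?enum_uniq //; apply: val_inj.
- by rewrite map_inj_uniq ?uniq_dyck_shapes //; apply: shape_word_inj.
move=> w; apply/mapP/mapP => [[t + ->]|[bs]].
  rewrite mem_enum inE => /andP[Dt /block_concatP[bs Ebs]].
  by exists bs; rewrite // mem_dyck_shapes -is_dyck_shape_word /shape_word -Ebs.
rewrite mem_dyck_shapes -is_dyck_shape_word => Dw ->.
have /eqP sz_w := size_dyck _ _ Dw.
exists (Tuple sz_w); rewrite // mem_enum inE /= Dw.
by apply/block_concatP; exists bs.
Qed.

Lemma schroder_seqs_shapes a n :
  perm_eq (schroder_seqs a.+1 n)
          (flatten [seq paths_of_shape n (rev bs) | bs <- dyck_shapes a n]).
Proof.
apply: uniq_perm; first exact: uniq_schroder_seqs.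
  apply: uniq_flatten_map => [|bs _|bs bs' p _ _]; first exact: uniq_dyck_shapes.
    exact: uniq_paths_of_shape.
  by move=> Pp /(paths_of_shape_inj _ _ _ _ Pp); apply: (can_inj revK).
have weight_rev bs : shape_weight n (rev bs) = shape_weight n bs.
  by rewrite /shape_weight (perm_big _ (permEl (perm_rev bs))).
move=> p; rewrite mem_schroder_seqs is_schroder_pathE.
apply/andP/flatten_mapP => [[/eqP Ex /eqP Ep]|[bs + Pp]].
  have [||bs Hbs] := paths_of_shape_exist n p; last 1 first.
  - exists (rev bs); rewrite ?revK // mem_dyck_shapes revK weight_rev.
    by rewrite -(xcoord_shape _ _ _ Hbs) -(final_height_shape _ _ _ _ _ Hbs) Ex Ep !eqxx.
  (* A path above y = (a + 1)x is also above y = x, hence factors into N's and primes. *)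
  - apply/final_heightP => i le_i.
    have /final_heightP/(_ i le_i) : final_height a.+1 0 p by rewrite Ep.
    by rewrite mulSn; lia.
  - by rewrite Ex.
rewrite mem_dyck_shapes -(final_height_shape _ _ _ _ _ Pp) -weight_rev.
by rewrite -(xcoord_shape _ _ _ Pp) => /andP.
Qed.

Theorem theorem3p1 (alpha n : nat) (alpha_gt0 : 0 < alpha) (n_gt0 : 0 < n) :
  #|schroder_paths alpha n| = #|colored_dyck sigma alpha.-1 n|.
Proof.
case: alpha alpha_gt0 => // a _ /=.
rewrite -size_schroder_seqs (perm_size (schroder_seqs_shapes a n)) size_flatten.
rewrite /shape -map_comp card_tagged !sumnE big_map [RHS]big_map.
pose weight w := \prod_(l <- ascents w) sigma (l %/ a.+1).
(* Both sides are sums over Dyck words: [weight] counts the colorings of a word and, equally, the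
   paths of the reversed shape. *)
transitivity (\sum_(w <- [seq val w | w <- enum (dyck_words a n)]) weight w).
  rewrite (perm_big _ (dyck_words_shapes a n)) /= big_map; apply: eq_bigr => bs _.
  rewrite size_paths_of_shape /weight prod_ascents_shape_word.
  (* The number of paths of a shape is a product over its entries, so reversal does not change
     it. *)
  exact: perm_big (permEl (perm_rev bs)).
rewrite big_map !big_enum /= (big_sub (dyck_words a n) (fun w => weight (val w))).
by apply: eq_bigr => w _; rewrite card_coloring.
Qed.
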